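(* Let $p$ be an odd prime and $n\geq 1$ an integer. Then the polynomials $P(p^n,p^n+1,x)$, $Q(p^n-1,p^n,x)$, $P(p^n,p^n,x)$ and $Q(p^n,p^n,x)$ are irreducible over $\mathbf{Q}$.
   Context: For positive integers $u,v$ define $P(u,v,x)=\sum_{j=0}^{u}\frac{(u+v-j)!}{v!}\binom{u}{j}x^j$ and $Q(u,v,x)=\sum_{j=0}^{v}\frac{(u+v-j)!}{u!}\binom{v}{j}(-x)^j$. *)

(* Defs.v *)
From mathcomp Require Import all_boot all_order all_algebra.

Set Implicit Arguments.
Unset Strict Implicit.
Unset Printing Implicit Defensive.

Import GRing.Theory.

Local Open Scope ring_scope.

(* Here j <= u (resp. j <= v), so the natural subtraction u + v - j is exact. *)

Definition P (u v : nat) : {poly rat} :=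
  \sum_(j < u.+1)
    (((u + v - j)`!)%:R / (v`!)%:R * ('C(u, j))%:R) *: 'X ^+ j.

Definition Q (u v : nat) : {poly rat} :=
  \sum_(j < v.+1)
    (((u + v - j)`!)%:R / (u`!)%:R * ('C(v, j))%:R) *: (- 'X) ^+ j.

(* Main.v *)
(* Put q = p^n and m = v_p(q!). The coefficient of X^j in the monic polynomial
   P(q,v,X) is C(q+v-j,v) q!/j!, and Q(u,v,X) = P(v,u,-X). For v in
   {q-1, q, q+1} the number C(q+v,v) is prime to p, because C(2q,q) = 2 mod p
   and p is odd. By Legendre's formula v_p(j!)/j <= m/q for 0 < j <= q and
   m = 1 mod p, so the p-adic Newton polygon of P(q,v,X) is one segment of
   slope -m/q with gcd(m,q) = 1, and Dumas' criterion applies.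
   Dumas' criterion: any complex root x of such an f makes x^q / p^m an
   algebraic integer, so a monic rational factor g of degree r satisfies
   g(0)^q = z p^(mr) with z an integer. Multiplying this by the same relation
   for the cofactor shows that z is prime to p; hence q divides mr, so q
   divides r. *)

Require Import Defs.
From mathcomp Require Import all_boot all_order all_algebra all_field.
From mathcomp Require Import ring.

Set Implicit Arguments.
Unset Strict Implicit.
Unset Printing Implicit Defensive.

Import Order.TTheory GRing.Theory Num.Theory.

Local Open Scope ring_scope.

(** * Integrality of roots rescaled by a slope *)

(** The row of the [e i] is a nonzero eigenvector of the integer matrix [A] for the eigenvalue [x],
    so [x] is a root of a monic integral characteristic polynomial. *)
Lemma Aint_stable_span (q : nat) (e : 'I_q -> algC) (x : algC) (i0 : 'I_q) :
  e i0 != 0 ->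
  (forall i, exists c : 'I_q -> int, x * e i = \sum_k (c k)%:~R * e k) ->
  x \in Aint.
Proof.
move=> nz_e /fin_all_exists [c def_xe].
pose A : 'M[int]_q := \matrix_(k, i) c i k.
have eigA : eigenvalue (map_mx intr A) x.
  apply/eigenvalueP; exists (\row_i e i).
    apply/rowP=> i; rewrite !mxE def_xe; apply: eq_bigr => k _.
    by rewrite !mxE mulrC.
  by apply: contraNneq nz_e => /rowP/(_ i0); rewrite !mxE => ->.
rewrite eigenvalue_root_char in eigA.
apply: root_monic_Aint eigA (char_poly_monic _) _.
rewrite -map_char_poly; apply/polyOverP=> i.
by rewrite coef_map intr_int.
Qed.

(* The Z-span of the numbers x^j / p^floor(mj/q), j < q, contains all those with
   j >= q as well, so it is stable under x^q / p^m. *)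
Lemma Aint_slope (p q m : nat) (a : nat -> int) (x : algC) :
  (0 < p)%N -> (0 < q)%N ->
  (forall i, (i < q)%N ->
    exists2 e, (m * (q - i) <= q * e)%N & (p%:Z ^+ e %| a i)%Z) ->
  x ^+ q = - \sum_(i < q) (a i)%:~R * x ^+ i ->
  x ^+ q / p%:R ^+ m \in Aint.
Proof.
move=> p_gt0 q_gt0 slope_a def_xq.
have p_nz k : p%:R ^+ k != 0 :> algC by rewrite expf_neq0 // pnatr_eq0 -lt0n.
pose e j : algC := x ^+ j / p%:R ^+ (m * j %/ q).
have spanP j : exists c : 'I_q -> int, e j = \sum_(k < q) (c k)%:~R * e k.
  have [n] := ubnP j; elim: n j => // n IHn j /ltnSE le_jn.
  have [lt_jq | le_qj] := ltnP j q.
    exists (fun k : 'I_q => (k == Ordinal lt_jq)%:Z).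
    rewrite (bigD1 (Ordinal lt_jq)) //= eqxx mul1r big1 ?addr0 // => k /negPf->.
    by rewrite mul0r.
  have step (i : 'I_q) : exists c : 'I_q -> int,
      - (a i)%:~R * x ^+ (i + (j - q)) / p%:R ^+ (m * j %/ q)
      = \sum_(k < q) (c k)%:~R * e k.
    have [E le_E /dvdzP[b ->]] := slope_a i (ltn_ord i).
    set k := (i + (j - q))%N.
    have lt_kn : (k < n)%N.
      apply: leq_trans le_jn; rewrite /k -(subnKC le_qj) addKn ltn_add2r.
      exact: ltn_ord.
    have [c def_ek] := IHn k lt_kn.
    (* As [j = k + (q - i)], the bound on [E] says that the power of [p] dividing [a i] makes up for
       the larger denominator of [e j]. *)
    have le_N : (m * j %/ q <= E + m * k %/ q)%N.
      rewrite -divnMDl // leq_div2r // [(E * q)%N]mulnC.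
      apply: leq_trans (leq_add le_E (leqnn _)).
      rewrite -mulnDr leq_mul2l /k addnA subnK ?subnKC ?leqnn ?orbT //.
      exact: ltnW.
    exists (fun l => - b * p%:Z ^+ (E + m * k %/ q - m * j %/ q) * c l).
    under eq_bigr => l _ do rewrite rmorphM /= -mulrA.
    rewrite -mulr_sumr -def_ek /e !(rmorphM, rmorphN, rmorphXn) /= -!pmulrn.
    rewrite -(mulrA (- _)) !mulNr; congr (- _); rewrite -!mulrA; congr (_ * _).
    rewrite mulrCA [RHS]mulrCA; congr (_ * _).
    apply: (mulIf (p_nz (m * j %/ q)%N)); rewrite divfK //.
    by rewrite mulrAC -exprD subnK // exprD mulfK.
  have [c def_c] := fin_all_exists step.
  exists (fun k => \sum_(i < q) c i k).
  under eq_bigr => k _ do rewrite rmorph_sum mulr_suml.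
  rewrite exchange_big /= -(eq_bigr _ (fun i _ => def_c i)) /e.
  rewrite -mulr_suml; congr (_ / _).
  rewrite -{1}(subnKC le_qj) exprD def_xq mulNr mulr_suml -sumrN.
  by apply: eq_bigr => i _; rewrite exprD mulNr mulrA.
apply: (@Aint_stable_span q (fun i => e i) _ (Ordinal q_gt0)) => [|i].
  by rewrite /e /= expr0 muln0 div0n divr1 oner_neq0.
(* The floor of m(i+q)/q is m plus that of mi/q, so x^q/p^m maps [e i] exactly to [e (i + q)]. *)
have [c def_c] := spanP (i + q)%N; exists c; rewrite -def_c /e.
by rewrite mulrC mulrACA -invfM -!exprD mulnDr divnDMl.
Qed.

(** Up to sign [g.[0]] is the product of the complex roots, so the number is, up to sign, the
    product of [x ^+ k * c] over these roots. *)
Lemma Aint_horner0 (g : {poly rat}) (k : nat) (c : algC) :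
  g \is monic ->
  (forall x, root (map_poly ratr g) x -> x ^+ k * c \in Aint) ->
  ratr g.[0] ^+ k * c ^+ (size g).-1 \in Aint.
Proof.
move=> mon_g AintP.
have [r def_g] := closed_field_poly_normal (map_poly ratr g : {poly algC}).
have mon_gC : map_poly ratr g \is @monic algC by rewrite map_monic.
rewrite (monicP mon_gC) scale1r in def_g.
rewrite -(size_map_poly (ratr : rat -> algC)) def_g size_prod_XsubC /=.
have -> : ratr g.[0] = (map_poly ratr g).[0] :> algC.
  by rewrite -horner_map /= rmorph0.
rewrite def_g.
have: {in r, forall x, x ^+ k * c \in Aint}.
  by move=> x r_x; apply: AintP; rewrite def_g root_prod_XsubC.
elim: r {def_g} => [|x r IHr] Air.
  by rewrite big_nil hornerC expr1n mulr1 Aint1.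
rewrite big_cons hornerM hornerXsubC sub0r exprMn exprS mulrACA rpredM //.
  by rewrite exprNn -mulrA rpredMsign Air ?mem_head.
by apply: IHr => y r_y; rewrite Air // inE r_y orbT.
Qed.

Lemma rat_Aint_int (x : rat) : ratr x \in Aint -> exists z : int, x = z%:~R.
Proof.
move=> Aint_x; have /intrP[z def_x] := Cint_rat_Aint (Crat_rat x) Aint_x.
exists z; apply: (fmorph_inj (ratr : {rmorphism rat -> algC})).
by rewrite /= def_x ratr_int.
Qed.

(** * Dumas' criterion for monic rational polynomials *)

Section Slope.

Variables (p q m : nat) (a : nat -> int) (f : {poly rat}).
Hypotheses (p_prime : prime p) (q_gt0 : (0 < q)%N).
Hypotheses (sz_f : size f = q.+1) (mon_f : f \is monic).
Hypothesis def_f : forall i, (i < q)%N -> f`_i = (a i)%:~R.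
Hypothesis slope_a : forall i, (i < q)%N ->
    exists2 e, (m * (q - i) <= q * e)%N & (p%:Z ^+ e %| a i)%Z.

Lemma root_slope (x : algC) :
  root (map_poly ratr f) x -> x ^+ q / p%:R ^+ m \in Aint.
Proof.
move=> /rootP; rewrite horner_coef size_map_poly sz_f big_ord_recr /=.
have -> : (map_poly ratr f)`_q = 1 :> algC.
  by have := monicP mon_f; rewrite lead_coefE sz_f coef_map /= => ->; rewrite rmorph1.
rewrite mul1r addrC => /eqP; rewrite addr_eq0 => /eqP def_xq.
apply: (@Aint_slope p q m a) => //; first exact: prime_gt0.
rewrite def_xq; congr (- _); apply: eq_bigr => i _.
by rewrite coef_map /= def_f // ratr_int.
Qed.

Lemma dvd_slope (g : {poly rat}) : g \is monic -> g %| f ->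
  exists b z : int,
    g.[0] = b%:~R /\ b ^+ q = z * p%:Z ^+ (m * (size g).-1).
Proof.
move=> mon_g dv_g.
have root_f (x : algC) : root (map_poly ratr g) x -> root (map_poly ratr f) x.
  by apply: root_dvdp; rewrite dvdp_map.
have Aint_gz : ratr (g.[0] ^+ q / p%:R ^+ (m * (size g).-1)) \in Aint.
  rewrite fmorph_div !rmorphXn /= ratr_nat exprM -exprVn.
  by apply: Aint_horner0 => // x /root_f/root_slope.
have [z def_z] := rat_Aint_int Aint_gz.
have p_nzQ : p%:R ^+ (m * (size g).-1) != 0 :> rat.
  by rewrite expf_neq0 // pnatr_eq0 -lt0n prime_gt0.
have {}def_z : g.[0] ^+ q = z%:~R * p%:R ^+ (m * (size g).-1).
  by rewrite -def_z divfK.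
(* [g.[0]] is a root of a monic integral binomial X^q - z p^(mr), where r is the degree of [g]. *)
have Aint_g0 : ratr g.[0] \in Aint.
  have := @root_monic_Aint ('X^q - (z * p%:Z ^+ (m * (size g).-1))%:~R%:P).
  apply.
  - rewrite /root !hornerE -rmorphXn /= def_z rmorphM rmorphXn /= ratr_int.
    by rewrite ratr_nat rmorphM rmorphXn /= -pmulrn subrr.
  - exact: monicXnsubC.
  - apply/polyOverP=> i; rewrite coefB coefXn coefC.
    by case: ifP => _; rewrite rpredB ?rpred_nat ?rpred0 ?intr_int.
have [b def_b] := rat_Aint_int Aint_g0; exists b, z; split=> //.
apply: (@intr_inj rat).
by rewrite rmorphXn /= -def_b def_z rmorphM rmorphXn /= -pmulrn.
Qed.

Hypotheses (co_qm : coprime q m) (a0_nz : a 0 != 0) (log_a0 : logn p `|a 0|%N = m).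

Lemma dumas_monic (g h : {poly rat}) : g \is monic -> h \is monic ->
  f = g * h -> (q %| (size g).-1)%N.
Proof.
move=> mon_g mon_h def_gh.
have dv_g: g %| f by rewrite def_gh dvdp_mulr.
have dv_h: h %| f by rewrite def_gh dvdp_mull.
have [b [y [g0 def_y]]] := dvd_slope mon_g dv_g.
have [c [z [h0 def_z]]] := dvd_slope mon_h dv_h.
have def_a0 : a 0 = b * c.
  apply: (@intr_inj rat); rewrite rmorphM /= -g0 -h0 -hornerM -def_gh.
  by rewrite horner_coef0 def_f.
have := a0_nz; rewrite def_a0 mulf_eq0 negb_or -!absz_gt0 => /andP[b_gt0 c_gt0].
have log_eq (d w : int) (k : nat) : (0 < `|d|)%N ->
    d ^+ q = w * p%:Z ^+ k -> (q * logn p `|d| = logn p `|w| + k)%N.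
  move=> d_gt0 def_d.
  have w_gt0 : (0 < `|w|)%N.
    rewrite absz_gt0; apply: contraTneq d_gt0 => w0; move/eqP: def_d.
    by rewrite w0 mul0r expf_eq0 q_gt0 => /eqP->.
  move/(congr1 (logn p \o absz)): def_d => /=.
  rewrite abszM !abszX absz_nat lognX => ->.
  by rewrite lognM // ?pfactorK // expn_gt0 prime_gt0.
have log_b := log_eq _ _ _ b_gt0 def_y; have log_c := log_eq _ _ _ c_gt0 def_z.
have sz_gh : (q = (size g).-1 + (size h).-1)%N.
  have := sz_f; rewrite def_gh size_monicM ?monic_neq0 //.
  have := monic_neq0 mon_g; have := monic_neq0 mon_h; rewrite -!size_poly_gt0.
  by case: (size g) (size h) => [|r] [|t] //= _ _; rewrite addnS => -[].
(* Adding [log_b] and [log_c] gives qm on the left, as [a 0 = b * c], and qm plus the valuations of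
   [y] and [z] on the right, as the degrees add up to [q]. *)
have log_y : logn p `|y| = 0%N.
  have: (q * m = q * m + (logn p `|y| + logn p `|z|))%N.
    rewrite -{1}log_a0 def_a0 abszM lognM // mulnDr log_b log_c.
    by rewrite addnACA -mulnDr -sz_gh addnC mulnC.
  by move/eqP; rewrite -[X in X == _]addn0 eqn_add2l eq_sym addn_eq0 => /andP[/eqP].
by rewrite -(Gauss_dvdr _ co_qm) -[(m * _)%N]add0n -log_y -log_b dvdn_mulr.
Qed.

(** A nonconstant divisor, once made monic, has as degree a positive multiple of [q], hence at least
    the degree of [f]. *)
Lemma dumas_irreducible : irreducible_poly f.
Proof.
split=> [|g sz_g dv_g]; first by rewrite sz_f.
have f_nz : f != 0 by rewrite monic_neq0.
have g_nz : g != 0 by apply: contraNneq f_nz => g0; rewrite -dvd0p -g0.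
have lg_nz : lead_coef g != 0 by rewrite lead_coef_eq0.
have sz_g' : (1 < size g)%N by rewrite ltn_neqAle eq_sym sz_g size_poly_gt0.
have mon_g : (lead_coef g)^-1 *: g \is monic.
  by rewrite monicE lead_coefZ mulVf.
have [h def_h] : exists h, f = ((lead_coef g)^-1 *: g) * h.
  have /dvdpP[h ->] := dv_g; exists (lead_coef g *: h).
  by rewrite -scalerAr -scalerAl scalerA mulfV // scale1r mulrC.
have mon_h : h \is monic by rewrite -(monicMl _ mon_g) -def_h.
have := dumas_monic mon_g mon_h def_h; rewrite size_scale ?invr_eq0 // => dv_q.
have le_q := dvdn_leq _ dv_q.
rewrite -dvdp_size_eqp // eqn_leq dvdp_leq //= sz_f.
by rewrite -(prednK (ltnW sz_g')) ltnS le_q // -ltnS prednK ?(ltnW sz_g').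
Qed.

End Slope.

(** * Binomial coefficients and factorials at a prime power *)

(** With q = p^n, i C(q,i) = q C(q-1,i-1); if p did not divide C(q,i), then q would divide i. *)
Lemma dvdn_bin_pfactor (p n i : nat) : prime p ->
  (0 < i < p ^ n)%N -> (p %| 'C(p ^ n, i))%N.
Proof.
move=> p_prime /andP[i_gt0 lt_iq]; apply: contraLR lt_iq => p'C; rewrite -leqNgt.
apply: dvdn_leq => //; rewrite -(@Gauss_dvdl _ _ 'C(p ^ n, i)).
  by case: i i_gt0 {p'C} => // i _; rewrite -mul_bin_diag dvdn_mulr.
by rewrite coprimeXl // prime_coprime.
Qed.

(** In Vandermonde's sum of C(q,i) C(q,q-i) the two end terms are 1 and [p] divides all others. *)
Lemma bin_double_pfactor (p n : nat) : prime p ->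
  'C(p ^ n + p ^ n, p ^ n) = 2 %[mod p].
Proof.
move=> p_prime; set q := (p ^ n)%N.
have q_gt0 : (0 < q)%N by rewrite expn_gt0 prime_gt0.
rewrite -binomial.Vandermonde big_ord_recr -(prednK q_gt0) big_ord_recl /= prednK //.
rewrite subn0 subnn bin0 binn !mul1n addnAC -[LHS]modnDmr.
suff /eqP-> : (p %| \sum_(i < q.-1) 'C(q, lift ord0 i) * 'C(q, q - lift ord0 i))%N.
  by rewrite addn0.
apply: dvdn_sum => i _; rewrite dvdn_mulr // dvdn_bin_pfactor // lift0 /=.
by rewrite -[X in (_ < X)%N](prednK q_gt0) ltnS.
Qed.

Lemma bin_pfactor_coprime (p n v : nat) : prime p -> odd p ->
  (p ^ n - 1 <= v <= p ^ n + 1)%N -> (0 < n)%N -> coprime p 'C(p ^ n + v, v).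
Proof.
move=> p_prime p_odd.
have co_p2 : coprime p 2 by rewrite coprime_sym coprime2n.
have := bin_double_pfactor n p_prime; set q := (p ^ n)%N => def_C.
have q_gt0 : (0 < q)%N by rewrite expn_gt0 prime_gt0.
have co_C : coprime p 'C(q + q, q) by rewrite -coprime_modr def_C coprime_modr.
move=> /andP[le_qv le_vq] n_gt0.
have [-> | [-> | ->]] : v = q.-1 \/ v = q \/ v = q.+1.
- move: le_qv le_vq; rewrite subn1 addn1 leq_eqVlt => /orP[/eqP-> | ]; first by left.
  rewrite prednK // leq_eqVlt => /orP[/eqP-> | ]; first by right; left.
  by move=> lt_qv le_vq; right; right; apply/eqP; rewrite eqn_leq le_vq.
(* Case v = q-1: a divisor of C(2q,q) is also prime to [p]. *)
- have: (2 * 'C(q + q.-1, q.-1) = 'C(q + q, q))%N.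
    apply/eqP; rewrite -(eqn_pmul2l q_gt0) mulnA muln2 -addnn.
    have := mul_bin_diag (q + q) q.-1; rewrite prednK // => <-.
    by rewrite -!subn1 addnBA.
  by move=> def2; rewrite -def2 coprimeMr in co_C; case/andP: co_C.
- by [].
(* Case v = q+1: (q+1) C(2q+1,q+1) = (2q+1) C(2q,q), and 2q+1 is 1 mod [p] because n > 0. *)
have: coprime p (q.+1 * 'C((q + q).+1, q.+1)).
  rewrite -mul_bin_diag coprimeMr co_C andbT -coprime_modr.
  have /eqP-> : (q + q).+1 == 1 %[mod p].
    rewrite -addn1 -[X in _ == X %[mod _]]add0n eqn_modDr mod0n.
    by rewrite -/(p %| q + q)%N dvdn_add // /q -(prednK n_gt0) expnS dvdn_mulr.
  by rewrite coprime_modr coprimen1.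
by rewrite addnS coprimeMr => /andP[].
Qed.

(** Legendre's sum, cut at [n] instead of [j]: terms with p^k > j vanish. The common range allows a
    termwise comparison for different [j]. *)
Lemma logn_fact_pfactor (p n j : nat) : prime p -> (j <= p ^ n)%N ->
  logn p j`! = (\sum_(1 <= k < n.+1) j %/ p ^ k)%N.
Proof.
move=> p_prime le_jq; rewrite logn_fact //.
have extend a b : (a <= b)%N -> (forall k, (a < k)%N -> (j < p ^ k)%N) ->
    (\sum_(1 <= k < b.+1) j %/ p ^ k = \sum_(1 <= k < a.+1) j %/ p ^ k)%N.
  move=> le_ab lt_j; rewrite (@big_cat_nat _ _ _ a.+1) //=.
  rewrite [X in (_ + X)%N]big_nat_cond [X in (_ + X)%N]big1 ?addn0 // => k.
  by rewrite andbT => /andP[/lt_j lt_jk _]; rewrite divn_small.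
rewrite -(@extend j (maxn j n)) ?leq_maxl // => [|k lt_jk].
  rewrite (@extend n) ?leq_maxr // => k lt_nk.
  by apply: leq_ltn_trans le_jq _; rewrite ltn_exp2l ?prime_gt1.
by apply: leq_trans lt_jk _; rewrite ltnW // ltn_expl ?prime_gt1.
Qed.

(** Termwise in Legendre's sums: p^n floor(j/p^k) <= j p^(n-k). *)
Lemma logn_fact_pfactor_le (p n j : nat) : prime p -> (j <= p ^ n)%N ->
  (p ^ n * logn p j`! <= j * logn p (p ^ n)`!)%N.
Proof.
move=> p_prime le_jq; rewrite !(@logn_fact_pfactor p n) // !big_distrr /=.
rewrite !big_add1 /= !big_mkord; apply: leq_sum => k _.
rewrite -expnB ?prime_gt0 // -{1}(subnK (ltn_ord k)) expnD -mulnA mulnC.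
by rewrite leq_mul // mulnC leq_divM.
Qed.

(** For n > 0 the valuation is p^(n-1) + ... + p + 1, which is 1 mod [p]. *)
Lemma coprime_logn_fact_pfactor (p n : nat) : prime p ->
  coprime (p ^ n) (logn p (p ^ n)`!).
Proof.
case: n => [|n] p_prime; first exact: coprime1n.
rewrite coprimeXl // prime_coprime // (@logn_fact_pfactor p n.+1) //.
rewrite big_nat_recr //= divnn expn_gt0 prime_gt0 // dvdn_addr.
  by rewrite dvdn1 neq_ltn prime_gt1 ?orbT.
rewrite big_add1 big_mkord; apply: dvdn_sum => k _.
rewrite -expnB ?prime_gt0 ?ltnS ?(ltnW (ltn_ord k)) //.
by rewrite subSS -(subnSK (ltn_ord k)) expnS dvdn_mulr.
Qed.

(** * Application to [P] and [Q] *)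

Lemma P_term_nat (u v j : nat) : (j <= u)%N ->
  ((u + v - j)`!)%:R / (v`!)%:R * ('C(u, j))%:R
    = ('C(u + v - j, v) * u ^_ (u - j))%:R :> rat.
Proof.
move=> le_ju; have nz_fact k : k`!%:R != 0 :> rat.
  by rewrite pnatr_eq0 -lt0n fact_gt0.
rewrite -addnBAC // -(@bin_fact (u - j + v) v) ?leq_addl // addnK.
rewrite -bin_ffact bin_sub // !natrM; field; exact: nz_fact.
Qed.

Lemma coef_P (u v j : nat) : (j <= u)%N ->
  (P u v)`_j = ('C(u + v - j, v) * u ^_ (u - j))%:R.
Proof.
move=> le_ju; rewrite -P_term_nat // /P coef_sum.
rewrite (bigD1 (Ordinal (le_ju : (j < u.+1)%N))) //= coefZ coefXn eqxx mulr1.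
rewrite big1 ?addr0 // => i ne_ij; rewrite coefZ coefXn.
case: eqP => [def_j | _]; last by rewrite mulr0.
by case/eqP: ne_ij; apply: val_inj.
Qed.

Lemma size_P (u v : nat) : size (P u v) = u.+1.
Proof.
apply/eqP; rewrite eqn_leq; apply/andP; split.
  by apply/leq_sizeP=> j lt_uj; rewrite /P coef_sum big1 // => i _;
     rewrite coefZ coefXn gtn_eqF ?mulr0 // (leq_trans (ltn_ord i)).
rewrite ltnNge; apply/negP=> /leq_sizeP/(_ u (leqnn u))/eqP.
by rewrite coef_P // addKn binn subnn oner_eq0.
Qed.

Lemma monic_P (u v : nat) : P u v \is monic.
Proof. by rewrite monicE lead_coefE size_P coef_P //= addKn binn subnn. Qed.

Lemma P_irreducible (p n v : nat) : prime p -> odd p -> (0 < n)%N ->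
  (p ^ n - 1 <= v <= p ^ n + 1)%N -> irreducible_poly (P (p ^ n) v).
Proof.
move=> p_prime p_odd n_gt0 v_q; set q := (p ^ n)%N.
have q_gt0 : (0 < q)%N by rewrite expn_gt0 prime_gt0.
have C_gt0 : (0 < 'C(q + v, v))%N by rewrite bin_gt0 leq_addl.
pose a j : int := ('C(q + v - j, v) * q ^_ (q - j))%N.
apply: (@dumas_irreducible p q (logn p q`!) a) => //.
- exact: size_P.
- exact: monic_P.
- by move=> j /ltnW le_jq; rewrite coef_P // /a -pmulrn.
(* The falling factorial is q!/j!, and its valuation alone meets the slope bound. *)
- move=> j /ltnW le_jq; exists (logn p (q ^_ (q - j))).
    have := logn_fact_pfactor_le p_prime le_jq; rewrite -/q.
    rewrite -(ffact_fact (leq_subr j q)) subKn // lognM ?fact_gt0 //; last first.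
      by rewrite ffact_gt0 leq_subr.
    move=> le_j; rewrite mulnBr leq_subLR (mulnC _ j).
    apply: leq_trans (leq_add le_j (leqnn _)).
    by rewrite -mulnDr mulnC addnC.
  by rewrite dvdzE abszX !absz_nat dvdn_mull // pfactor_dvdnn.
- exact: coprime_logn_fact_pfactor.
- by rewrite -absz_gt0 /a !subn0 ffactnn absz_nat muln_gt0 C_gt0 fact_gt0.
(* The binomial factor of [a 0] is prime to [p], so its valuation is exactly that of q!. *)
rewrite /a !subn0 ffactnn absz_nat lognM ?fact_gt0 //.
by rewrite logn_coprime ?bin_pfactor_coprime.
Qed.

(** Substituting -X is an involution that preserves size and divisibility. *)
Lemma irreducible_comp_oppX (F : fieldType) (f : {poly F}) :
  irreducible_poly f -> irreducible_poly (f \Po - 'X).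
Proof.
have szX : size (- 'X : {poly F}) = 2 by rewrite size_polyN size_polyX.
have compK (g : {poly F}) : (g \Po - 'X) \Po - 'X = g.
  by rewrite -comp_polyA raddfN /= comp_polyX opprK comp_polyXr.
case=> sz_f irr_f; split=> [|g sz_g /dvdpP[h def_f]].
  by rewrite size_comp_poly2.
rewrite -dvdp_size_eqp ?def_f ?dvdp_mull // -def_f size_comp_poly2 //.
rewrite -(size_comp_poly2 g szX) dvdp_size_eqp ?irr_f ?size_comp_poly2 //.
  by rewrite -(compK f) def_f comp_polyM dvdp_mull.
by rewrite -(compK f) def_f comp_polyM dvdp_mull.
Qed.

Lemma Q_comp_P (u v : nat) : Q u v = P v u \Po - 'X.
Proof.
rewrite /Q /P raddf_sum /=; apply: eq_bigr => j _.
by rewrite comp_polyZ comp_Xn_poly (addnC u).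
Qed.

Theorem theorem2p10 (p n : nat) (p_prime : prime p) (p_odd : odd p)
    (n_ge1 : (1 <= n)%N) :
  [/\ irreducible_poly (P (p ^ n)%N (p ^ n + 1)%N),
      irreducible_poly (Q (p ^ n - 1)%N (p ^ n)%N),
      irreducible_poly (P (p ^ n)%N (p ^ n)%N)
    & irreducible_poly (Q (p ^ n)%N (p ^ n)%N)].
Proof.
have le_q := leq_subr 1 (p ^ n); have le_q1 := leq_addr 1 (p ^ n).
have le_q2 := leq_trans le_q le_q1.
by rewrite !Q_comp_P; split; try apply: irreducible_comp_oppX;
   apply: P_irreducible; rewrite ?leqnn ?le_q ?le_q1 ?le_q2.
Qed.
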